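(* If $\mathcal{A}$ is an irreducible (essential) reflection arrangement of rank $n$ in a complex vector space $V$ (so $n = \dim V$), then $|\mathcal{A}| \geq n(n+1)/2$.
   Context: $V$ is a nonzero finite-dimensional $\mathbb{C}$-vector space. A hyperplane arrangement in $V$ is a finite collection of linear hyperplanes; it is essential if the intersection of its members is $\{0\}$, and the rank of an essential arrangement is $\dim V$. A reflection arrangement is one of the form $\{\mathrm{Ker}(s-1) : s \text{ a reflection of } W\}$, where $W \subset \mathrm{GL}(V)$ is a finite group generated by (pseudo-)reflections (finite-order elements $s$ such that $\mathrm{Ker}(s-1)$ is a hyperplane). For arrangements $\mathcal{A}_1,\mathcal{A}_2$ in $V_1,V_2$, the arrangement $\mathcal{A}_1 \times \mathcal{A}_2$ in $V_1 \oplus V_2$ is $\{H \oplus V_2 : H \in \mathcal{A}_1\} \cup \{V_1 \oplus H : H \in \mathcal{A}_2\}$. An essential arrangement is irreducible if it is not isomorphic (via a linear isomorphism of ambient spaces) to such a product with $V_1$ and $V_2$ both nonzero. *)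

(* Defs.v *)
From HB Require Import structures.
From mathcomp Require Export all_boot all_order all_algebra.
From mathcomp Require Export finmap complex reals.

Set Implicit Arguments.
Unset Strict Implicit.
Unset Printing Implicit Defensive.

Import GRing.Theory.

Local Open Scope ring_scope.
Local Open Scope fset_scope.
Local Open Scope lfun_scope.

Section Arrangements.
Variables (K : fieldType) (V : vectType K).

Definition hyperplane (H : {vspace V}) : Prop := (\dim H).+1 = \dim {:V}.

Definition arrangement (A : {fset {vspace V}}) : Prop :=
  forall H, H \in A -> hyperplane H.

Definition essential (A : {fset {vspace V}}) : Prop :=
  (\bigcap_(H <- A) H = 0)%VS.

Definition finite_order (s : 'End(V)) : Prop :=
  exists2 m, (0 < m)%N & iter m (fun g : 'End(V) => s \o g) \1 = \1.

Definition reflection (s : 'End(V)) : Prop :=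
  finite_order s /\ hyperplane (lker (s - \1)).

(* For an endomorphism g with trivial kernel, the partial inverse g^-1 of the
   library is the two-sided inverse of g. *)
Definition GL_subgroup (G : 'End(V) -> Prop) : Prop :=
  [/\ forall g, G g -> lker g = 0%VS,
      G \1,
      forall g h, G g -> G h -> G (g \o h) &
      forall g, G g -> G (g^-1)].

(* The intersection of the subgroups of GL(V) that contain S; it is only
   meaningful when the elements of S are invertible. *)
Definition generated_subgroup (S : 'End(V) -> Prop) (g : 'End(V)) : Prop :=
  forall G, GL_subgroup G -> (forall s, S s -> G s) -> G g.

Definition reflection_group (W : {fset 'End(V)}) : Prop :=
  exists2 S : 'End(V) -> Prop, (forall s, S s -> reflection s) &
    forall g, g \in W <-> generated_subgroup S g.

Definition reflection_arrangement (A : {fset {vspace V}}) : Prop :=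
  exists2 W : {fset 'End(V)}, reflection_group W &
    forall H, H \in A <->
      exists s, [/\ s \in W, reflection s & H = lker (s - \1)].

End Arrangements.

Section Products.
Variables (K : fieldType) (V1 V2 : vectType K).

(* U1 (+) U2 inside V1 (+) V2. *)
Definition prodv (U1 : {vspace V1}) (U2 : {vspace V2}) :
    {vspace (V1 * V2)%type} :=
  (linfun (@fst V1 V2) @^-1: U1 :&: linfun (@snd V1 V2) @^-1: U2)%VS.

Lemma memv_prodv U1 U2 (x : V1 * V2) :
  (x \in prodv U1 U2) = (x.1 \in U1) && (x.2 \in U2).
Proof. by rewrite memv_cap -!memv_preim !lfunE. Qed.

Definition prod_arrangement
    (A1 : {fset {vspace V1}}) (A2 : {fset {vspace V2}}) :
    {fset {vspace (V1 * V2)%type}} :=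
  [fset prodv H fullv | H in A1] `|` [fset prodv fullv H | H in A2].

End Products.

Definition isomorphic_arrangements (K : fieldType) (V V' : vectType K)
    (A : {fset {vspace V}}) (A' : {fset {vspace V'}}) : Prop :=
  exists f : 'Hom(V, V'),
    [/\ lker f = 0%VS, limg f = fullv & A' = [fset (f @: H)%VS | H in A]].

Definition irreducible_arrangement (K : fieldType) (V : vectType K)
    (A : {fset {vspace V}}) : Prop :=
  ~ exists (V1 V2 : vectType K)
           (A1 : {fset {vspace V1}}) (A2 : {fset {vspace V2}}),
      [/\ (0 < \dim {:V1})%N /\ (0 < \dim {:V2})%N,
          arrangement A1,
          arrangement A2 &
          isomorphic_arrangements A (prod_arrangement A1 A2)].

(* Main.v *)
(* Choose reflections s_1, ..., s_n of W one at a time so that each s_(k+1) fails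
   to commute with some earlier s_i and does not fix the common fixed space X_k
   of s_1, ..., s_k pointwise; irreducibility of A makes this possible and gives
   dim X_k = n - k.  The hyperplanes of A containing X_(k+1) but not X_k are
   permuted by s_1, ..., s_k, so their intersection Y is stable under these.  As
   the s_i are linked, Y must be fixed by all of them, that is Y <= X_k, and
   so Y <= X_(k+1) has codimension at least k+1.  Hence there are at least k+1
   such hyperplanes at step k, and 1 + 2 + ... + n in total. *)

From HB Require Import structures.
Require Import Defs.
From mathcomp Require Import all_boot all_order all_algebra.
From mathcomp Require Import finmap complex reals.

Import GRing.Theory.

Local Open Scope ring_scope.

(** * Hyperplanes, root lines and subspaces stable under a reflection *)

Section Subspaces.
Set Implicit Arguments.
Unset Strict Implicit.
Variables (K : fieldType) (V : vectType K).
Implicit Types (U X Y H : {vspace V}) (s t g : 'End(V)).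

Lemma subv_bigcap_seq (I : eqType) (r : seq I) (F : I -> {vspace V}) U :
  (U <= \bigcap_(i <- r) F i)%VS = all (fun i => U <= F i)%VS r.
Proof.
elim: r => [|i r IHr]; first by rewrite big_nil subvf.
by rewrite big_cons subv_cap IHr.
Qed.

Lemma hyperplane_neq_full H : hyperplane H -> ~~ (fullv <= H)%VS.
Proof.
by move=> dH; apply/negP => /dimvS; rewrite -dH ltnn.
Qed.

Lemma dim_cap_hyperplane X H :
  hyperplane H -> ~~ (X <= H)%VS -> (\dim (X :&: H)).+1 = \dim X.
Proof.
move=> dH nXH; have fXH: (X + H)%VS = fullv.
  apply/eqP; rewrite eqEdim subvf /= -dH ltn_neqAle.
  rewrite (dimv_leqif_eq (addvSr X H)) dimvS ?addvSr // andbT.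
  by apply: contra nXH => /eqP ->; exact: addvSl.
by have /eqP := dimv_sum_cap X H; rewrite fXH -dH addSn -addnS addnC eqn_add2r => /eqP.
Qed.

(** Each hyperplane lowers the dimension by at most one; this turns a codimension into a count of
    hyperplanes. *)
Lemma dim_bigcap_hyperplanes (r : seq {vspace V}) :
  (forall H, H \in r -> hyperplane H) ->
  (\dim {:V} <= \dim (\bigcap_(H <- r) H)%VS + size r)%N.
Proof.
elim: r => [|H r IHr] hr; first by rewrite big_nil addn0.
rewrite big_cons /=.
apply: leq_trans (IHr _) _ => [H' H'r|]; first by apply: hr; rewrite inE H'r orbT.
rewrite addnS -addSn leq_add2r capvC.
have [le|nle] := boolP (\bigcap_(H' <- r) H' <= H)%VS.
  by move/capv_idPl: le => ->.
by rewrite (dim_cap_hyperplane (hr H (mem_head _ _))).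
Qed.

Lemma dim_root s : reflection s -> \dim (limg (s - \1%VF)) = 1%N.
Proof.
case=> _ hs; have := limg_ker_dim (s - \1%VF) fullv.
by rewrite capfv -hs -addn1 => /eqP; rewrite eqn_add2l => /eqP.
Qed.

(** If [s] moves some [y] in [Y], then [s y - y] lies in [Y] and spans the root line
    [limg (s - \1)]. *)
Lemma stable_reflection s Y : reflection s -> (s @: Y <= Y)%VS ->
  (Y <= fixedSpace s)%VS || (limg (s - \1%VF) <= Y)%VS.
Proof.
move=> rs sY; case: (boolP (_ <= _)%VS) => //= /subvPn [y Yy nfy].
have sy0 : (s - \1%VF) y != 0 by rewrite -memv_ker.
have -> : limg (s - \1%VF) = <[(s - \1%VF) y]>%VS.
  apply/esym/eqP; rewrite eqEdim dim_root // dim_vline sy0 andbT -memvE.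
  exact/memv_img/memvf.
rewrite -memvE add_lfunE opp_lfunE id_lfunE memvB //.
by apply: (subvP sY); exact: memv_img.
Qed.

Lemma finite_order_lker s : finite_order s -> lker s = 0%VS.
Proof.
case=> -[//|m] _ /= sm; have lims : limg s = fullv.
  apply/eqP; rewrite eqEsubv subvf /=; apply/subvP => v _.
  by rewrite -[v]id_lfunE -sm comp_lfunE memv_img ?memvf.
have /eqP := limg_ker_dim s fullv.
by rewrite lims capfv -[X in _ == X]add0n eqn_add2r dimv_eq0 => /eqP.
Qed.

End Subspaces.

(** * Linked families of reflections and their stable subspaces *)

Section IrreducibleFamilies.
Set Implicit Arguments.
Unset Strict Implicit.
Variables (K : fieldType) (V : vectType K).
Implicit Types (X Y H : {vspace V}) (s t g : 'End(V)) (T : seq 'End(V)).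

(** Equivalently, each stable subspace is fixed pointwise by the whole family or contains all its
    root lines. *)
Definition irreducible_family T : Prop :=
  forall Y, (forall s, s \in T -> (s @: Y <= Y)%VS) ->
  forall s t, s \in T -> t \in T ->
    (Y <= fixedSpace s)%VS || (limg (t - \1%VF) <= Y)%VS.

Definition common_fixed T : {vspace V} := (\bigcap_(s <- T) fixedSpace s)%VS.

Lemma common_fixedS T s : s \in T -> (common_fixed T <= fixedSpace s)%VS.
Proof.
move=> sT; have := subvv (common_fixed T).
by rewrite {2}/common_fixed subv_bigcap_seq => /allP/(_ s sT).
Qed.

Lemma irreducible_family1 t : reflection t -> irreducible_family [:: t].
Proof.
move=> rt Y sY s u; rewrite !inE => /eqP -> /eqP ->.
by apply: stable_reflection => //; rewrite sY ?mem_head.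
Qed.

(** The link carries the alternative across. If [t] moves [Y], its root line lies in [Y] and is
    moved by [s], so [Y] contains all root lines of [T]. If some member of [T] moves [Y], the root
    line of [s] lies in [Y] and is moved by [t]. *)
Lemma irreducible_family_cons T s t :
    irreducible_family T -> s \in T -> reflection t ->
    ~~ (limg (s - \1%VF) <= fixedSpace t)%VS ->
    ~~ (limg (t - \1%VF) <= fixedSpace s)%VS ->
  irreducible_family (t :: T).
Proof.
move=> irrT sT rt nst nts Y stY u w uT wT.
have stT x : x \in T -> (x @: Y <= Y)%VS by move=> xT; rewrite stY ?inE ?xT ?orbT.
have tY := stable_reflection rt (stY t (mem_head _ _)).
case: (boolP (Y <= _)%VS) => //= nYu.
suff [tsubY TsubY] : (limg (t - \1%VF) <= Y)%VS /\
    (forall x, x \in T -> (limg (x - \1%VF) <= Y)%VS).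
  by move: wT; rewrite inE => /orP[/eqP ->|/TsubY].
move: uT; rewrite inE => /orP[/eqP ut|uT].
  move: nYu tY; rewrite ut => /negPf -> /= tY; split=> // x xT.
  have := irrT Y stT s x sT xT; case: (boolP (Y <= _)%VS) => //= Ys.
  by rewrite (subv_trans tY Ys) in nts.
have TY x : x \in T -> (limg (x - \1%VF) <= Y)%VS.
  by move=> xT; have := irrT Y stT u x uT xT; rewrite (negPf nYu).
split=> //; case/orP: tY => // Yt.
by rewrite (subv_trans (TY s sT) Yt) in nst.
Qed.

End IrreducibleFamilies.

(** * Generated subgroups, and finite linear groups in characteristic zero *)

Lemma generated_GL_subgroup (K : fieldType) (V : vectType K)
    (S : 'End(V) -> Prop) :
  (forall s, S s -> lker s = 0%VS) -> GL_subgroup (generated_subgroup S).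
Proof.
move=> kS; split=> [g gen||g h Gg Gh G GG SG|g Gg G GG SG].
(* Invertibility comes from testing against the group of all maps with trivial kernel. *)
- apply: gen kS; split=> [//||g1 g2 /eqP/lker0P k1 /eqP/lker0P k2|g1 /eqP k1].
  + by apply/eqP/lker0P => x y; rewrite !id_lfunE.
  + by apply/eqP/lker0P => x y; rewrite !comp_lfunE => /k1/k2.
  + by apply/eqP/lker0P; exact: can_inj (lker0_lfunVK k1).
- by move=> G [].
- by case: (GG) => _ _ + _; apply; [apply: Gg | apply: Gh].
- by case: (GG) => _ _ _; apply; apply: Gg.
Qed.

Section FiniteGroup.
Set Implicit Arguments.
Unset Strict Implicit.
Variables (K : fieldType) (V : vectType K) (W : {fset 'End(V)}).
Hypothesis char0 : [pchar K] =i pred0.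
Hypothesis groupW : GL_subgroup (fun g => g \in W).
Implicit Types (X Y H : {vspace V}) (s t g : 'End(V)).

Lemma lker_group g : g \in W -> lker g == 0%VS.
Proof. by case: groupW => kW _ _ _ /kW ->. Qed.

Lemma comp_group g h : g \in W -> h \in W -> (g \o h)%VF \in W.
Proof. by case: groupW => _ _ + _; apply. Qed.

Lemma inv_group g : g \in W -> (g^-1)%VF \in W.
Proof. by case: groupW => _ _ _; apply. Qed.

(* Otherwise the vectors g^i v = v + i (g v - v) would be pairwise distinct. *)
Lemma fixed_displacement g v : g \in W -> g (g v - v) = g v - v -> g v = v.
Proof.
move=> gW gx; apply/eqP; rewrite -subr_eq0; apply/negPn/negP => x0.
set x := g v - v in gx x0; pose h i := iter i (fun f : 'End(V) => (g \o f)%VF) \1%VF.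
have hW i : h i \in W.
  elim: i => [|i IHi]; first by case: groupW.
  exact: comp_group.
have hv i : h i v = v + x *+ i.
  elim: i => [|i IHi]; first by rewrite id_lfunE addr0.
  rewrite /h iterS comp_lfunE -/(h i) IHi linearD linearMn /= gx mulrS addrA.
  by congr (_ + _); rewrite /x [v + _]addrC subrK.
have h_inj : injective h.
  move=> i j /(congr1 (fun f : 'End(V) => f v)); rewrite !hv => /addrI.
  wlog le_ij : i j / (i <= j)%N.
    by case/orP: (leq_total i j) => [le /(_ _ _ le)|le /(_ _ _ le) IH /esym /IH].
  rewrite -(subnKC le_ij) mulrnDr -[LHS]addr0 => /addrI/esym/eqP.
  rewrite -scaler_nat scaler_eq0 (negPf x0) orbF.
  by rewrite (pcharf0P _).1 // => /eqP ->; rewrite addn0.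
have : (size [seq h i | i <- iota 0 #|` W|.+1] <= size W)%N.
  apply: uniq_leq_size; first by rewrite map_inj_uniq ?iota_uniq.
  by move=> f /mapP [i _ ->].
by rewrite size_map size_iota ltnn.
Qed.

Lemma root_fixedP s t :
  reflect (forall v, t (s v - v) = s v - v) (limg (s - \1%VF) <= fixedSpace t)%VS.
Proof.
apply: (iffP fixedSpacesP) => [h v|h x].
  by apply: h; rewrite -[v in X in _ - X]id_lfunE -opp_lfunE -add_lfunE memv_img ?memvf.
by case/memv_imgP => v _ ->; rewrite add_lfunE opp_lfunE id_lfunE h.
Qed.

(* The commutator of s and t moves every vector by a vector of the root line
   of t, which it fixes; hence it is trivial. *)
Lemma root_fixed_sym s t : s \in W -> t \in W ->
  (limg (t - \1%VF) <= fixedSpace s)%VS -> (limg (s - \1%VF) <= fixedSpace t)%VS.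
Proof.
move=> sW tW /root_fixedP st; have [s0 t0] := (lker_group sW, lker_group tW).
have d_mor y : t^-1%VF (t y - y) = t (t^-1%VF y) - t^-1%VF y.
  by rewrite linearB /= lker0_lfunK ?lker0_lfunVK.
have stC u : s (t u) = t (s u).
  pose g := (s \o (t \o (s^-1 \o t^-1)))%VF.
  have gW : g \in W by rewrite !(comp_group, inv_group).
  have gE y : g y = s (t (s^-1%VF (t^-1%VF y))) by rewrite !comp_lfunE.
  have gw : g (t (s u)) = s (t u) by rewrite gE !lker0_lfunK.
  (* Commutation at [u] says that the commutator [g] fixes [t (s u)]. *)
  rewrite -gw; apply: fixed_displacement => //.
  have -> : g (t (s u)) - t (s u) = t (u - s u) - (u - s u).
    have /eqP := st u; rewrite linearB subr_eq /= => /eqP stu.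
    rewrite gw stu linearB opprB /= -addrA addrACA [RHS]addrACA.
    by congr (_ + _); rewrite addrC.
  (* [t^-1] preserves the image of [t - 1], where [s^-1] acts trivially; then [t] undoes [t^-1], and
     [s] acts trivially again. *)
  rewrite gE d_mor -[X in s^-1%VF X]st lker0_lfunK // -d_mor.
  by rewrite lker0_lfunVK // st.
apply/root_fixedP => v; have /eqP := st v; rewrite !linearB /= stC subr_eq => /eqP ->.
by rewrite addrAC [t v - v]addrC addrK addrC.
Qed.

(* Averaging: the sum of w v over W is fixed by W, hence zero, and it is |W| v
   modulo Y. *)
Lemma roots_span (S : 'End(V) -> Prop) Y :
    (forall g, g \in W <-> generated_subgroup S g) ->
    (forall s, S s -> limg (s - \1%VF) <= Y)%VS ->
    (forall v, (forall s, s \in W -> s v = v) -> v = 0) ->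
  Y = fullv.
Proof.
move=> genW SY fix0; have SW s : S s -> s \in W by move=> Ss; apply/genW => G _; apply.
have WY g : g \in W -> forall v, g v - v \in Y.
  (* The injective maps inducing the identity modulo [Y] form a group that contains [S], hence
     [W]. *)
  move=> /genW gen; pose G h := lker h = 0%VS /\ forall v, h v - v \in Y.
  suff [] : G g by []; apply: gen => [|s Ss]; last first.
    split=> [|v]; first exact/eqP/lker_group/SW.
    apply: (subvP (SY s Ss)); rewrite -[v in X in _ - X]id_lfunE -opp_lfunE -add_lfunE.
    exact/memv_img/memvf.
  split=> [h []//||h1 h2 [/eqP/lker0P k1 Y1] [/eqP/lker0P k2 Y2]|h [/eqP k hY]].
  - split=> [|v]; last by rewrite id_lfunE subrr mem0v.
    by apply/eqP/lker0P => x y; rewrite !id_lfunE.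
  - split=> [|v]; last by rewrite comp_lfunE -(subrKA (h2 v)) memvD.
    by apply/eqP/lker0P => x y; rewrite !comp_lfunE => /k1/k2.
  - split=> [|v].
      by apply/eqP/lker0P; exact: can_inj (lker0_lfunVK k).
    by rewrite -memvN opprB -{1}[v](lker0_lfunVK k) hY.
have sum0 v : \sum_(w <- W) w v = 0.
  apply: fix0 => s sW.
  have sinj : injective (fun w : 'End(V) => (s \o w)%VF).
    by apply: (can_inj (g := fun w => (s^-1 \o w)%VF)) => w; rewrite lker0_compKf ?lker_group.
  have permW : perm_eq [seq (s \o w)%VF | w <- W] W.
    apply: uniq_perm; rewrite ?map_inj_uniq ?fset_uniq //.
    apply: (uniq_min_size _ _ _).2; rewrite ?map_inj_uniq ?size_map ?fset_uniq //.
    by move=> f /mapP [w wW ->]; exact: comp_group.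
  rewrite linear_sum -[RHS](perm_big _ permW) big_map /=.
  by apply: eq_bigr => w _; rewrite comp_lfunE.
apply/eqP; rewrite eqEsubv subvf; apply/subvP => v _.
have : \sum_(w <- W) (w v - v) \in Y.
  by rewrite big_seq; apply: memv_suml => w wW; exact: WY.
rewrite sumrB sum0 sub0r memvN big_const_seq count_predT iter_addr_0.
have W0 : ((size W)%:R : K) != 0.
  rewrite (pcharf0P _).1 // -lt0n -has_predT; apply/hasP; exists \1%VF => //.
  by case: groupW.
by rewrite -scaler_nat => /(memvZ (size W)%:R^-1); rewrite scalerA mulVf // scale1r.
Qed.

End FiniteGroup.

(** * Splitting an arrangement along a direct sum *)

Section DirectSum.
Set Implicit Arguments.
Unset Strict Implicit.
Variables (K : fieldType) (V : vectType K) (A : {fset {vspace V}}).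
Implicit Types (Q X H : {vspace V}).

(** The preimage is [Q :&: H] seen inside [subvs_of Q]; the inclusion preserves dimensions. *)
Lemma trace_hyperplane Q H : hyperplane H -> ~~ (Q <= H)%VS ->
  hyperplane (linfun (@vsval K V Q) @^-1: H)%VS.
Proof.
move=> dH nQH; set j := linfun _.
have jE w : j w = vsval w by rewrite lfunE.
have j0 : lker j == 0%VS by apply/lker0P => x y; rewrite !jE => /subvs_inj.
have limj : limg j = Q.
  apply/vspaceP => v; apply/memv_imgP/idP => [[w _ ->]|vQ]; first by rewrite jE subvsP.
  by exists (vsproj Q v); rewrite ?memvf // jE vsprojK.
have dimj U : \dim (j @: U) = \dim U.
  by rewrite limg_dim_eq // (eqP j0) capv0.
rewrite /hyperplane -dimj -[RHS]dimj -lpreim_cap_limg lpreimK ?capvSr // limj capvC.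
exact: dim_cap_hyperplane.
Qed.

(** The two projections identify [V] with the product of [Q] and [X]; a hyperplane containing one
    summand is the product of that summand with its trace on the other. *)
Lemma direct_sum_reducible Q X :
    arrangement A -> (0 < \dim Q)%N -> (0 < \dim X)%N ->
    (Q :&: X = 0)%VS -> (Q + X = fullv)%VS ->
    (forall H, H \in A -> (X <= H)%VS || (Q <= H)%VS) ->
  ~ irreducible_arrangement A.
Proof.
move=> hA Q0 X0 QX0 QXf AQX irrA.
case: irrA.
have XQ0 : (X :&: Q = 0)%VS by rewrite capvC.
pose jQ := linfun (@vsval K V Q); pose jX := linfun (@vsval K V X).
pose f0 v := (vsproj Q (daddv_pi Q X v), vsproj X (daddv_pi X Q v)).
have f0_lin : linear f0 by move=> a u v; rewrite /f0 !linearP.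
pose f0M := GRing.isLinear.Build K V _ _ f0 f0_lin.
pose f0L : {linear V -> _} := HB.pack f0 f0M.
pose f := linfun f0L.
have fE v : f v = f0 v by rewrite lfunE.
have f_sum v : vsval (f v).1 + vsval (f v).2 = v.
  by rewrite fE /= !vsprojK ?memv_pi // daddv_pi_add // QXf memvf.
have f0_ker : lker f == 0%VS.
  by apply/lker0P => u v fuv; rewrite -(f_sum u) fuv f_sum.
have f_eq w : f (vsval w.1 + vsval w.2) = w.
  set v := _ + _; have dxQX : directv (Q + X) by apply/directv_addP.
  have /eqP := f_sum v; rewrite {2}/v (directv_add_unique dxQX) ?subvsP //.
  rewrite xpair_eqE => /andP [/eqP/val_inj e1 /eqP/val_inj e2].
  by rewrite [LHS]surjective_pairing e1 e2 -surjective_pairing.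
have limf : limg f = fullv.
  apply/eqP; rewrite eqEsubv subvf; apply/subvP => w _.
  by rewrite -(f_eq w) memv_img ?memvf.
have fH H w : (w \in f @: H)%VS = (vsval w.1 + vsval w.2 \in H).
  rewrite -{1}(f_eq w); apply/memv_imgP/idP => [[v vH]|wH]; last by exists (vsval w.1 + vsval w.2).
  by rewrite f_eq => ->; rewrite f_sum.
have fHX H : (X <= H)%VS -> (f @: H = prodv (jQ @^-1: H) fullv)%VS.
  move=> XH; apply/vspaceP => w; rewrite memv_prodv fH memvf andbT -memv_preim lfunE /=.
  by rewrite rpredDr // (subvP XH) // subvsP.
have fHQ H : (Q <= H)%VS -> (f @: H = prodv fullv (jX @^-1: H))%VS.
  move=> QH; apply/vspaceP => w; rewrite memv_prodv fH memvf -memv_preim lfunE /=.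
  by rewrite rpredDl // (subvP QH) // subvsP.
have not_both H : H \in A -> (Q <= H)%VS -> (X <= H)%VS -> False.
  move=> HA QH XH; have := hyperplane_neq_full (hA H HA).
  by rewrite -QXf subv_add QH XH.
(* The hyperplanes containing [X] give the factor in [Q], those containing [Q] the factor in [X]. *)
pose AX := [fset H in A | (X <= H)%VS]%fset; pose AQ := [fset H in A | (Q <= H)%VS]%fset.
exists (subvs_of Q), (subvs_of X).
exists [fset (jQ @^-1: H)%VS | H in AX]%fset, [fset (jX @^-1: H)%VS | H in AQ]%fset.
split; first by rewrite !dimvf.
- move=> H1 /imfsetP [H /=]; rewrite !inE => /andP [HA XH] ->.
  apply: trace_hyperplane; first exact: hA.
  by apply/negP => QH; exact: not_both HA QH XH.
- move=> H1 /imfsetP [H /=]; rewrite !inE => /andP [HA QH] ->.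
  apply: trace_hyperplane; first exact: hA.
  by apply/negP => XH; exact: not_both HA QH XH.
exists f; split=> //; first exact/eqP.
apply/fsetP => P; rewrite in_fsetU; apply/orP/imfsetP => [[]|[H /= HA ->]].
- case/imfsetP => H1 /= /imfsetP [H /=]; rewrite !inE => /andP [HA XH] -> ->.
  by exists H => //; rewrite fHX.
- case/imfsetP => H1 /= /imfsetP [H /=]; rewrite !inE => /andP [HA QH] -> ->.
  by exists H => //; rewrite fHQ.
case/orP: (AQX H HA) => [XH|QH]; [left|right]; apply/imfsetP => /=.
  exists (jQ @^-1: H)%VS; last exact: fHX.
  by apply/imfsetP; exists H; rewrite //= !inE HA.
exists (jX @^-1: H)%VS; last exact: fHQ.
by apply/imfsetP; exists H; rewrite //= !inE HA.
Qed.

End DirectSum.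

(** * The group action on reflecting hyperplanes *)

Section ReflectingHyperplanes.
Set Implicit Arguments.
Unset Strict Implicit.
Variables (K : fieldType) (V : vectType K) (W : {fset 'End(V)}).
Variable (A : {fset {vspace V}}).
Hypothesis char0 : [pchar K] =i pred0.
Hypothesis groupW : GL_subgroup (fun g => g \in W).
Hypothesis AE : forall H, H \in A <->
  exists s, [/\ s \in W, reflection s & H = fixedSpace s].
Implicit Types (X Y H : {vspace V}) (s t g : 'End(V)) (T : seq 'End(V)).

Lemma hyperplane_arrangement H : H \in A -> hyperplane H.
Proof. by case/AE => s [_ [_ hs] ->]. Qed.

(** Pulling back the fixed space of [s] by [g] gives that of the conjugate reflection [g^-1 s g]. *)
Lemma arrangement_preim g H : g \in W -> H \in A -> (g @^-1: H)%VS \in A.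
Proof.
move=> gW /AE [s [sW [[m m0 sm] hs] ->]]; have g0 := lker_group groupW gW.
set u := (g^-1 \o (s \o g))%VF.
have uE v : u v = g^-1%VF (s (g v)) by rewrite !comp_lfunE.
have fixu : (g @^-1: fixedSpace s)%VS = fixedSpace u.
  apply/vspaceP => v; rewrite -memv_preim.
  apply/fixedSpaceP/fixedSpaceP => [e|]; rewrite uE; first by rewrite e lker0_lfunK.
  by move=> e; rewrite -[in RHS]e lker0_lfunVK.
apply/AE; exists u; split=> //; first by rewrite !(comp_group groupW, inv_group groupW).
split; last first.
  rewrite /hyperplane -[lker _]fixu; have gf := lker0_limgf g0.
  have /limg_dim_eq <- : (g @^-1: fixedSpace s :&: lker g = 0)%VS by rewrite (eqP g0) capv0.
  by rewrite lpreimK // gf subvf.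
exists m => //; have iterE i v :
    iter i (fun f : 'End(V) => (u \o f)%VF) \1%VF v =
    g^-1%VF (iter i (fun f : 'End(V) => (s \o f)%VF) \1%VF (g v)).
  elim: i => [|i IHi] /=; first by rewrite !id_lfunE lker0_lfunK.
  by rewrite !comp_lfunE IHi lker0_lfunVK.
by apply/lfunP => v; rewrite iterE sm !id_lfunE lker0_lfunK.
Qed.

(* The hyperplanes of A containing X' but not X are permuted by T, so their
   intersection Y is T-stable; since Y does not contain the root line of s,
   irreducibility forces Y <= X'. *)
Lemma new_hyperplanes T s t (X := common_fixed T) (X' := (fixedSpace t :&: X)%VS) :
    {subset T <= W} -> irreducible_family T -> s \in T ->
    t \in W -> reflection t ->
    ~~ (limg (s - \1%VF) <= fixedSpace t)%VS -> ~~ (X <= fixedSpace t)%VS ->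
  (\dim {:V} <= \dim X' + #|` [fset H in A | (X' <= H)%VS && ~~ (X <= H)%VS]%fset|)%N.
Proof.
move=> TW irrT sT tW rt nst nXt; set O := [fset H in A | _]%fset.
have OE H : (H \in O) = [&& H \in A, (X' <= H)%VS & ~~ (X <= H)%VS] by rewrite !inE.
have tO : fixedSpace t \in O.
  by rewrite OE capvSl nXt !andbT; apply/AE; exists t.
pose Y := (\bigcap_(H <- O) H)%VS.
have YO H : H \in O -> (Y <= H)%VS.
  by move=> HO; have := subvv Y; rewrite {2}/Y subv_bigcap_seq => /allP/(_ H HO).
have stY u : u \in T -> (u @: Y <= Y)%VS.
  move=> uT; have uW := TW u uT; have u0 := lker_group groupW uW.
  have fixX x : x \in X -> u x = x.
    by move=> xX; apply/fixedSpaceP; apply: (subvP (common_fixedS uT)).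
  rewrite {2}/Y subv_bigcap_seq; apply/allP => H; rewrite OE => /and3P [HA X'H nXH].
  (* As [u] fixes [X], hence also [X'], pointwise, pulling back by [u] respects both conditions
     defining [O]. *)
  have uO : (u @^-1: H)%VS \in O.
    rewrite OE (arrangement_preim uW HA) /=; apply/andP; split.
      apply/subvP => x; rewrite memv_cap -memv_preim => /andP [xt xX].
      by rewrite fixX // (subvP X'H) // memv_cap xt.
    apply: contra nXH => /subvP XH; apply/subvP => x xX.
    by rewrite -(fixX x xX) memv_preim XH.
  apply: subv_trans (limgS u (YO _ uO)) _.
  by rewrite lpreimK // (lker0_limgf u0) subvf.
have YX : (Y <= X)%VS.
  rewrite subv_bigcap_seq; apply/allP => u uT.
  have := irrT Y stY u s uT sT; case: (boolP (Y <= _)%VS) => //= _ sY.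
  by rewrite (subv_trans sY (YO _ tO)) in nst.
have YX' : (Y <= X')%VS by rewrite subv_cap YX YO.
apply: leq_trans (dim_bigcap_hyperplanes (r := O) _) _.
  by move=> H; rewrite OE => /andP [HA _]; exact: hyperplane_arrangement.
by rewrite leq_add2r dimvS.
Qed.

(** * The chain of common fixed spaces and the count *)

Variable S : 'End(V) -> Prop.
Hypothesis reflS : forall s, S s -> reflection s.
Hypothesis genW : forall g, g \in W <-> generated_subgroup S g.
Hypothesis essA : essential A.
Hypothesis irrA : irreducible_arrangement A.

Lemma fixedSpace_arrangement s : s \in W -> reflection s -> fixedSpace s \in A.
Proof. by move=> sW rs; apply/AE; exists s. Qed.

Lemma bigcap_arrangement X : (forall H, H \in A -> (X <= H)%VS) -> X = 0%VS.
Proof.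
move=> XA; apply/eqP; rewrite -subv0 -essA subv_bigcap_seq.
by apply/allP => H; exact: XA.
Qed.

(* Otherwise V would be the direct sum of X and of the intersection Q of the
   hyperplanes of A not containing X: each root line lies in X or Q. *)
Lemma linked_reflection T (X := common_fixed T) :
    (forall s, s \in T -> s \in W /\ reflection s) -> T <> [::] -> X <> 0%VS ->
  exists s t, [/\ s \in T, t \in W, reflection t,
    ~~ (limg (s - \1%VF) <= fixedSpace t)%VS & ~~ (X <= fixedSpace t)%VS].
Proof.
move=> TW T0 X0.
pose linked H := ~~ (X <= H)%VS && has (fun s => ~~ (limg (s - \1%VF) <= H)%VS) T.
case: (boolP (has linked A)) => [/hasP [H HA /andP [nXH /hasP [s sT nsH]]]|/hasPn unlinked].
  by have /AE [t [tW rt Ht]] := HA; exists s, t; rewrite -Ht.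
pose Q := (\bigcap_(H <- [seq H <- A | ~~ (X <= H)%VS]) H)%VS.
have QH H : H \in A -> ~~ (X <= H)%VS -> (Q <= H)%VS.
  move=> HA nXH; have := subvv Q; rewrite {2}/Q subv_bigcap_seq => /allP; apply.
  by rewrite mem_filter nXH.
have AXQ H : H \in A -> (X <= H)%VS || (Q <= H)%VS.
  by move=> HA; case: (boolP (X <= H)%VS) => //= /(QH H HA).
(* As nothing is linked, [u] fixes the root lines of [T]; by symmetry [T] fixes that of [u]. *)
have rootX u : u \in W -> reflection u -> ~~ (X <= fixedSpace u)%VS ->
    (limg (u - \1%VF) <= X)%VS.
  move=> uW ru nXu; rewrite subv_bigcap_seq; apply/allP => v vT.
  have [vW _] := TW v vT; apply: (root_fixed_sym char0 groupW) => //.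
  have := unlinked _ (fixedSpace_arrangement uW ru).
  by rewrite /linked nXu /= => /hasPn /(_ v vT); rewrite negbK.
have QX0 : (Q :&: X = 0)%VS.
  apply: bigcap_arrangement => H /AXQ /orP [XH|].
    exact: subv_trans (capvSr _ _) XH.
  exact: subv_trans (capvSl _ _).
have QXf : (Q + X = fullv)%VS.
  apply: (roots_span char0 groupW genW) => [s Ss|v fixv]; last first.
    apply/eqP; rewrite -memv0 -(@bigcap_arrangement <[v]>%VS) ?memv_line //.
    by move=> H /AE [s [sW _ ->]]; rewrite -memvE; apply/fixedSpaceP; exact: fixv.
  have rs := reflS Ss; have sW : s \in W by apply/genW => G _; apply.
  have [Xs|nXs] := boolP (X <= fixedSpace s)%VS; last first.
    exact: subv_trans (rootX s sW rs nXs) (addvSr _ _).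
  (* Here [s] fixes [X], which contains the root line of each [u] moving [X]; by symmetry [u] fixes
     the root line of [s], which therefore lies in [Q]. *)
  apply: subv_trans (addvSl _ _); rewrite subv_bigcap_seq; apply/allP => H.
  rewrite mem_filter => /andP [nXH /AE [u [uW ru Hu]]]; rewrite Hu in nXH *.
  by apply: (root_fixed_sym char0 groupW) => //; apply: subv_trans Xs; exact: rootX.
case: (direct_sum_reducible _ _ _ QX0 QXf AXQ irrA); first exact: hyperplane_arrangement.
  (* If [Q] were zero, [X] would be everything, yet it lies in the fixed hyperplane of a member of
     [T]. *)
  rewrite lt0n dimv_eq0; apply/negP => /eqP Q0; move: QXf; rewrite Q0 add0v => Xf.
  case: T T0 TW @X {X0 linked unlinked Q QH AXQ rootX QX0 Q0} Xf => // s T _ TW X Xf.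
  have [_ [_ /hyperplane_neq_full]] := TW s (mem_head _ _).
  by rewrite -Xf common_fixedS ?mem_head.
by rewrite lt0n dimv_eq0; apply/eqP.
Qed.

(** Induction on [k], the binomial being 1 + 2 + ... + k. It starts at [k = 1], since linking
    requires a nonempty family. *)
Lemma flag_count k : (0 < k <= \dim {:V})%N ->
  exists T, [/\ forall s, s \in T -> s \in W /\ reflection s, T <> [::],
    irreducible_family T, (\dim (common_fixed T) + k = \dim {:V})%N &
    ('C(k.+1, 2) <= #|` [fset H in A | (common_fixed T <= H)%VS]%fset|)%N].
Proof.
case: k => // k /=; elim: k => [|k IHk] le_k.
  have /hasP [H HA _] : has predT A.
    rewrite has_predT lt0n; apply/eqP => A0.
    have : fullv = 0%VS :> {vspace V}.
      by apply: bigcap_arrangement => H; rewrite (cardfs0_eq A0).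
    by move/eqP; rewrite -dimv_eq0 -leqn0 leqNgt le_k.
  have /AE [s [sW rs Hs]] := HA.
  have fix1 : common_fixed [:: s] = fixedSpace s by rewrite /common_fixed big_seq1.
  exists [:: s]; split=> //.
  - by move=> t; rewrite inE => /eqP ->.
  - exact: irreducible_family1.
  - by rewrite fix1 addn1; case: rs.
  rewrite binn cardfs_gt0; apply/fset0Pn; exists H.
  by rewrite !inE HA fix1 -Hs subvv.
have [T [TW T0 irrT dimT cardT]] := IHk (ltnW le_k).
have X0 : common_fixed T <> 0%VS.
  by move=> X0; move: le_k; rewrite -dimT X0 dimv0 add0n ltnn.
have [s [t [sT tW rt nst nXt]]] := linked_reflection TW T0 X0.
have [sW rs] := TW s sT.
have XE : common_fixed (t :: T) = (fixedSpace t :&: common_fixed T)%VS.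
  by rewrite /common_fixed big_cons.
have dimX : (\dim (common_fixed (t :: T)) + k.+2 = \dim {:V})%N.
  rewrite addnS -addSn XE capvC dim_cap_hyperplane //; by case: rt.
exists (t :: T); split=> //.
- by move=> u; rewrite inE => /orP [/eqP ->|/TW].
- apply: (irreducible_family_cons irrT sT rt nst).
  by apply: contra nst; exact: (root_fixed_sym char0 groupW).
have TsubW : {subset T <= W} by move=> u /TW [].
have := new_hyperplanes TsubW irrT sT tW rt nst nXt.
rewrite -XE -dimX leq_add2l; set O := [fset _ | _ in _ & _]%fset => cardO.
(* Pascal's rule: the hyperplanes containing [X] from the previous stage and the [k.+2] new ones,
   which do not contain it, are disjoint. *)
rewrite binS bin1; apply: leq_trans (leq_add cardT cardO) _.
rewrite -cardfsUI; set I := (_ `&` _)%fset.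
have -> : I = fset0.
  by apply/fsetP => H; rewrite !inE; case: (_ <= H)%VS; rewrite ?andbF.
rewrite cardfs0 addn0; apply: fsubset_leq_card; apply/fsubsetP => H.
rewrite !inE XE => /orP [] /andP [-> /=]; last by case/andP.
exact: subv_trans (capvSr _ _).
Qed.

End ReflectingHyperplanes.


Local Open Scope fset_scope.

Theorem corollary4p3 (R : realType) (V : vectType R[i]) (n : nat)
    (A : {fset {vspace V}})
    (V_nonzero : (0 < \dim {:V})%N)
    (A_arrangement : arrangement A)
    (A_reflection : reflection_arrangement A)
    (A_essential : essential A)
    (A_irreducible : irreducible_arrangement A)
    (A_rank : \dim {:V} = n) :
  ((n * (n + 1)) %/ 2 <= #|` A|)%N.
Proof.
have [W [S reflS genW] AE] := A_reflection.
have [kS oS cS vS] : GL_subgroup (generated_subgroup S).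
  by apply: generated_GL_subgroup => s /reflS [/finite_order_lker].
have groupW : GL_subgroup (fun g => g \in W).
  split=> [g /genW /kS||g h /genW gW /genW hW|g /genW gW] //; apply/genW => //.
  - exact: cS.
  - exact: vS.
(* At [k = n] the binomial is n(n+1)/2 and the hyperplanes counted form a subset of [A]. *)
have [|T [_ _ _ _]] := flag_count (Num.Theory.pchar_num _) groupW AE reflS genW
  A_essential A_irreducible (k := n).
  by rewrite -A_rank V_nonzero leqnn.
rewrite bin2 /= mulnC -divn2 addn1 => /leq_trans; apply.
by apply: fsubset_leq_card; apply/fsubsetP => H; rewrite !inE => /andP [].
Qed.
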